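(* Let $p\in\Delta_{m-1}$ and $\{p^\nu\}_{\nu\in\mathbb N}\subset\Delta_{m-1}$ with $p^\nu\to p$. For $(u,X)\in\mathbb R^{N_T}\times\mathbb R^n$ let $$f_2(u,X)=-\sum_{j=1}^mp_j\langle S_{T+1}(j),X_T(j^-)\rangle+\iota_{\mathcal X(u)}(X),\qquad f_2^\nu(u,X)=-\sum_{j=1}^mp_j^\nu\langle S_{T+1}(j),X_T(j^-)\rangle+\iota_{\mathcal X(u)}(X),$$ with associated dual functions $\psi_2,\psi_2^\nu:\mathbb R^{N_T}\to\overline{\mathbb R}$. Then $\psi_2^\nu$ hypo-converges to $\psi_2$.
   Context: Scenario tree. Let $T,k\ge 1$ be integers and consider a finite rooted tree with levels $0,1,\dots,T+1$ (the history tree of a finitely supported discrete-time environment process), in which every node at a level $\le T$ has at least one child. For $0\le t\le T$, $I_t$ is the set of nodes at level $t$ ($I_0$ consists of the root), $n_t=|I_t|$, $N_T=\sum_{t=0}^T n_t$, $n=(k+1)N_T$. The terminal nodes (level $T+1$) are labeled $1,\dots,m$. For a node $i$, $i^-$ is its parent and $i^+$ its set of children. The terminal nodes are partitioned into original scenarios $I$ and added critical scenarios $\tilde I$ (all nodes at levels $\le T$ belong to the original tree). Market. Asset prices are $S_t(i)=(S_t^0,S_t^1(i),\dots,S_t^k(i))\in(0,\infty)^{k+1}$ for each node $i$ at level $t$; asset $0$ is risk-free (its price depends only on $t$). For $j\in\tilde I$ and $1\le i\le k$, $S^i_{T+1}(j)=\kappa_j^iS^i_T(j^-)$ with $\kappa_j^i>0$.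 The original market is arbitrage-free (no self-financing strategy with zero initial wealth has terminal wealth that is nonnegative a.s. and positive with positive probability). The claim is $G_0>0$ and $G_t(i)<0$ for $i\in I_t$, $1\le t\le T$. Probabilities. $\Delta_{m-1}=\{p\in\mathbb R^m_+:\sum_jp_j=1\}$; $p_j$ is the probability of terminal node $j$, with $p_j=0$ for $j\in\tilde I$; $p^\nu$ may charge any scenario. Strategies and perturbed feasible sets. $X\in\mathbb R^n$ is a family $X_t(i)\in\mathbb R^{k+1}$, $i\in I_t$, $0\le t\le T$. A claim perturbation $u\in\mathbb R^{N_T}$ has one component $u_t(i)$ per node $i\in I_t$, $0\le t\le T$. $\mathcal X(u)$ is the set of all $X$ with $X_t(i)\ge0$ componentwise for all $i\in I_t$, $0\le t\le T$; $\langle S_0,X_0\rangle\le G_0+u_0$; and $\langle S_t(i),X_t(i)-X_{t-1}(i^-)\rangle\le G_t(i)+u_t(i)$ for all $i\in I_t$, $1\le t\le T$. $\iota_C$ is the indicator function ($0$ on $C$, $+\infty$ off $C$). The dual function associated with $f:\mathbb R^{N_T}\times\mathbb R^n\to\overline{\mathbb R}$ is $\psi(y)=\inf_{(u,X)}\{f(u,X)-\langle y,u\rangle\}$. Epi-convergence: $g^\nu:\mathbb R^N\to\overline{\mathbb R}$ epi-converges to $g$ if for every $x$: (1) $\liminf_\nu g^\nu(x^\nu)\ge g(x)$ for every $x^\nu\to x$; (2) there is $x^\nu\to x$ with $\limsup_\nu g^\nu(x^\nu)\le g(x)$. $g^\nu$ hypo-converges to $g$ if $-g^\nu$ epi-converges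 to $-g$. *)

(* Defs.v *)
From mathcomp Require Import all_boot all_order all_algebra.
From mathcomp Require Import boolp classical_sets reals ereal topology.
From mathcomp Require Import normedtype sequences.

Set Implicit Arguments.
Unset Strict Implicit.
Unset Printing Implicit Defensive.

Import Order.TTheory GRing.Theory Num.Theory.
Import numFieldNormedType.Exports.

Local Open Scope classical_set_scope.
Local Open Scope ring_scope.

Definition dotp (R : realType) (d : nat) (u v : 'rV[R]_d) : R :=
  \sum_(l < d) u 0 l * v 0 l.

(** The nodes at levels 0, ..., T are numbered by 'I_N, so that N is the number
    N_T = n_0 + ... + n_T, and the terminal nodes (level T + 1) by 'I_m.  The
    value of [parent] at the root is meaningless and never used.  [original] is
    the set I of original scenarios; its complement is the set of added
    critical scenarios.  [original_child] says that every node at level T, hence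
    every node at a level at most T, belongs to the original tree; it contains
    the fact that the nodes at level T have at least one child. *)
Record scenario_tree (T N m : nat) := ScenarioTree {
  level : 'I_N -> nat ;
  tree_root : 'I_N ;
  parent : 'I_N -> 'I_N ;
  leaf_parent : 'I_m -> 'I_N ;
  original : {set 'I_m} ;
  level_le : forall i, (level i <= T)%N ;
  level_eq0 : forall i, (level i == 0%N) = (i == tree_root) ;
  level_parent : forall i, i != tree_root -> level i = (level (parent i)).+1 ;
  level_leaf_parent : forall j, level (leaf_parent j) = T ;
  has_child : forall i, (level i < T)%N ->
    exists2 c, c != tree_root & parent c = i ;
  original_child : forall i, level i = T ->
    exists2 j, j \in original & leaf_parent j = i }.

(** Row i of [price] is S_t(i) for i at level t <= T; row j of [leaf_price] is
    S_{T+1}(j).  Column 0 is the risk-free asset; the risky asset number l + 1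
    is the column [lift ord0 l] for l : 'I_k. *)
Record market (R : realType) (k T N m : nat) (tr : scenario_tree T N m) :=
Market {
  price : 'M[R]_(N, k.+1) ;
  leaf_price : 'M[R]_(m, k.+1) ;
  kappa : 'M[R]_(m, k) ;
  price_gt0 : forall i l, 0 < price i l ;
  leaf_price_gt0 : forall j l, 0 < leaf_price j l ;
  price_riskfree : forall i i', level tr i = level tr i' ->
    price i ord0 = price i' ord0 ;
  leaf_price_riskfree : forall j j', leaf_price j ord0 = leaf_price j' ord0 ;
  kappa_gt0 : forall j l, j \notin original tr -> 0 < kappa j l ;
  leaf_price_critical : forall j l, j \notin original tr ->
    leaf_price j (lift ord0 l) =
    kappa j l * price (leaf_parent tr j) (lift ord0 l) }.

Definition simplex (R : realType) (m : nat) (p : 'rV[R]_m) : Prop :=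
  (forall j, 0 <= p 0 j) /\ \sum_(j < m) p 0 j = 1.

Definition claim (R : realType) (T N m : nat) (tr : scenario_tree T N m)
    (G : 'rV[R]_N) : Prop :=
  0 < G 0 (tree_root tr) /\ forall i, i != tree_root tr -> G 0 i < 0.

Section Market.
Context (R : realType) (k T N m : nat) (tr : scenario_tree T N m).
Variable M : market R k tr.

(** Row i of a strategy X : 'M_(N, k.+1) is the portfolio X_t(i). *)

Definition trade_cost (X : 'M[R]_(N, k.+1)) (i : 'I_N) : R :=
  dotp (row i (price M)) (row i X - row (parent tr i) X).

Definition initial_wealth (X : 'M[R]_(N, k.+1)) : R :=
  dotp (row (tree_root tr) (price M)) (row (tree_root tr) X).

Definition terminal_wealth (X : 'M[R]_(N, k.+1)) (j : 'I_m) : R :=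
  dotp (row j (leaf_price M)) (row (leaf_parent tr j) X).

Definition self_financing (X : 'M[R]_(N, k.+1)) : Prop :=
  forall i, i != tree_root tr -> trade_cost X i = 0.

(** Absence of arbitrage under p; the strategies may take short positions.
    When p vanishes outside [original tr] this concerns the original market
    only. *)
Definition arbitrage_free (p : 'rV[R]_m) : Prop :=
  ~ exists X : 'M[R]_(N, k.+1),
      [/\ self_financing X, initial_wealth X = 0,
          (forall j, 0 < p 0 j -> 0 <= terminal_wealth X j)
        & (exists2 j, 0 < p 0 j & 0 < terminal_wealth X j)].

Definition feasible (G u : 'rV[R]_N) : set 'M[R]_(N, k.+1) :=
  [set X : 'M[R]_(N, k.+1) |
    [/\ (forall i l, 0 <= X i l),
        initial_wealth X <= G 0 (tree_root tr) + u 0 (tree_root tr)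
      & (forall i, i != tree_root tr -> trade_cost X i <= G 0 i + u 0 i)]].

End Market.

Definition cvx_indicator (R : realType) (A : Type) (C : set A) (x : A) :
  \bar R := if `[< C x >] then 0%E else +oo%E.

Definition f2 (R : realType) (k T N m : nat) (tr : scenario_tree T N m)
    (M : market R k tr) (G : 'rV[R]_N) (p : 'rV[R]_m)
    (u : 'rV[R]_N) (X : 'M[R]_(N, k.+1)) : \bar R :=
  ((- \sum_(j < m) p 0 j * terminal_wealth M X j)%:E
   + cvx_indicator R (feasible M G u) X)%E.

Definition dual_fun (R : realType) (N : nat) (A : Type)
    (f : 'rV[R]_N -> A -> \bar R) (y : 'rV[R]_N) : \bar R :=
  ereal_inf [set (f uX.1 uX.2 - (dotp y uX.1)%:E)%E | uX in [set: 'rV[R]_N * A]].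

Definition epi_converges (R : realType) (N : nat)
    (g_ : nat -> 'rV[R]_N -> \bar R) (g : 'rV[R]_N -> \bar R) : Prop :=
  forall x : 'rV[R]_N,
    (forall x_ : nat -> 'rV[R]_N, x_ @ \oo --> x ->
       (g x <= limn_einf (fun nu => g_ nu (x_ nu)))%E) /\
    (exists2 x_ : nat -> 'rV[R]_N, x_ @ \oo --> x &
       (limn_esup (fun nu => g_ nu (x_ nu)) <= g x)%E).

Definition hypo_converges (R : realType) (N : nat)
    (g_ : nat -> 'rV[R]_N -> \bar R) (g : 'rV[R]_N -> \bar R) : Prop :=
  epi_converges (fun nu x => (- g_ nu x)%E) (fun x => (- g x)%E).

(* Main.v *)
(** Minimizing the Lagrangian over u and over X >= 0 gives psi_2(y) = <y, G> when
    y is dual feasible, i.e. y <= 0 and every reduced cost (the coefficient of a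
    component of X) is nonnegative, and psi_2(y) = -oo otherwise.  Since the set
    of dual feasible pairs (p, y) is closed, the upper limit inequality follows.
    For recovery sequences, a negative multiplier z decaying fast enough with the
    level has reduced costs that compensate any perturbation of the probabilities
    of size 1, so that y + |p^nu - p|_1 z is dual feasible for p^nu whenever y is
    for p. *)

Require Import Defs.
From mathcomp Require Import all_boot all_order all_algebra.
From mathcomp Require Import boolp classical_sets reals ereal topology.
From mathcomp Require Import normedtype sequences.
From mathcomp Require Import lra.

Import Order.TTheory GRing.Theory Num.Theory.
Import numFieldNormedType.Exports.
Local Open Scope classical_set_scope.
Local Open Scope ring_scope.

(** Grouping the indices by their image under [h] turns a sum over leaves or children into one over
    parents, so that the entries of [X] can be factored out. *)
Lemma sum_fiber {R : comNzRingType} {N m d : nat} (P : pred 'I_m)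
    (h : 'I_m -> 'I_N) (a : 'I_m -> 'I_d -> R) (X : 'M[R]_(N, d)) :
  \sum_(j < m | P j) \sum_(l < d) a j l * X (h j) l =
  \sum_(i < N) \sum_(l < d) X i l * \sum_(j < m | P j && (h j == i)) a j l.
Proof.
rewrite (partition_big h predT) //=; apply: eq_bigr => i _.
rewrite exchange_big; apply: eq_bigr => l _; rewrite big_distrr /=.
by apply: eq_bigr => j /andP[_ /eqP <-]; rewrite mulrC.
Qed.

Lemma dotpDr {R : realType} {d : nat} (u v w : 'rV[R]_d) :
  dotp u (v + w) = dotp u v + dotp u w.
Proof. by rewrite -big_split; apply: eq_bigr => l _; rewrite mxE mulrDr. Qed.

Lemma dotpNr {R : realType} {d : nat} (u v : 'rV[R]_d) :
  dotp u (- v) = - dotp u v.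
Proof. by rewrite -sumrN; apply: eq_bigr => l _; rewrite mxE mulrN. Qed.

(** * Lagrangian duality and restoration of dual feasibility *)

Section Dual.
Context {R : realType} {k T N m : nat} {tr : scenario_tree T N m}.
Variable M : market R k tr.

Definition cost (X : 'M[R]_(N, k.+1)) : 'rV[R]_N :=
  \row_i if i == tree_root tr then initial_wealth M X else trade_cost M X i.

(** The coefficient of X i l in the Lagrangian of the problem with multiplier y. *)
Definition reduced_cost (p : 'rV[R]_m) (y : 'rV[R]_N) (i : 'I_N)
    (l : 'I_k.+1) : R :=
  - \sum_(j < m | leaf_parent tr j == i) p 0 j * leaf_price M j l
  - y 0 i * price M i l
  + \sum_(c < N | (c != tree_root tr) && (parent tr c == i))
      y 0 c * price M c l.

Definition dual_feasible (p : 'rV[R]_m) (y : 'rV[R]_N) : Prop :=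
  (forall i, y 0 i <= 0) /\ (forall i l, 0 <= reduced_cost p y i l).

Lemma reduced_costD (p q : 'rV[R]_m) (y z : 'rV[R]_N) i l :
  reduced_cost (p + q) (y + z) i l = reduced_cost p y i l + reduced_cost q z i l.
Proof.
rewrite /reduced_cost mxE.
under eq_bigr do rewrite mxE mulrDl.
under [X in _ + X]eq_bigr do rewrite mxE mulrDl.
rewrite !big_split /=; lra.
Qed.

Lemma reduced_costZ (p : 'rV[R]_m) (y : 'rV[R]_N) (a : R) i l :
  reduced_cost (a *: p) (a *: y) i l = a * reduced_cost p y i l.
Proof.
rewrite /reduced_cost mxE.
under eq_bigr do rewrite mxE -mulrA.
under [X in _ + X]eq_bigr do rewrite mxE -mulrA.
rewrite -!big_distrr /=; lra.
Qed.

(** Summation by parts on the tree: the portfolio at [i] enters the budget of [i] and, with opposite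
    sign, that of each child of [i], or the terminal wealth if [i] has level [T]. *)
Lemma lagrangian (p : 'rV[R]_m) (y : 'rV[R]_N) (X : 'M[R]_(N, k.+1)) :
  - \sum_(j < m) p 0 j * terminal_wealth M X j - dotp y (cost X) =
  \sum_(i < N) \sum_(l < k.+1) X i l * reduced_cost p y i l.
Proof.
have -> : \sum_(j < m) p 0 j * terminal_wealth M X j =
    \sum_(i < N) \sum_(l < k.+1) X i l *
      \sum_(j < m | leaf_parent tr j == i) p 0 j * leaf_price M j l.
  rewrite -(sum_fiber predT); apply: eq_bigr => j _.
  rewrite big_distrr /=; apply: eq_bigr => l _.
  by rewrite !mxE mulrA.
have -> : dotp y (cost X) =
    \sum_(i < N) \sum_(l < k.+1) X i l * (y 0 i * price M i l)
    - \sum_(i < N) \sum_(l < k.+1) X i l *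
      \sum_(c < N | (c != tree_root tr) && (parent tr c == i))
        y 0 c * price M c l.
  rewrite -(sum_fiber (fun c => c != tree_root tr)) [X in _ - X]big_mkcond /=.
  rewrite -sumrB /dotp.
  apply: eq_bigr => i _; rewrite mxE; case: eqP => [->|_] /=.
    rewrite subr0 big_distrr /=; apply: eq_bigr => l _.
    by rewrite !mxE; lra.
  rewrite -sumrB big_distrr /=; apply: eq_bigr => l _.
  by rewrite !mxE; lra.
rewrite -opprD -sumrB -big_split -sumrN /=.
apply: eq_bigr => i _; rewrite -sumrB -big_split -sumrN /=.
by apply: eq_bigr => l _; rewrite /reduced_cost; lra.
Qed.

Lemma feasibleP (G u : 'rV[R]_N) (X : 'M[R]_(N, k.+1)) :
  feasible M G u X <->
  (forall i l, 0 <= X i l) /\ (forall i, cost X 0 i <= G 0 i + u 0 i).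
Proof.
split=> [[X0 h0 h]|[X0 h]]; split=> //.
- by move=> i; rewrite mxE; case: eqP => [->|/eqP /h].
- by have := h (tree_root tr); rewrite mxE eqxx.
- by move=> i /negbTE ir; have := h i; rewrite mxE ir.
Qed.

(** Test point: [u] is chosen so that the budgets hold with slack exactly [s]. As [X] and [s] are
    arbitrary nonnegative, each dual constraint can be probed separately. *)
Lemma dual_fun_le (G : 'rV[R]_N) (p : 'rV[R]_m) (y s : 'rV[R]_N)
    (X : 'M[R]_(N, k.+1)) :
  (forall i l, 0 <= X i l) -> (forall i, 0 <= s 0 i) ->
  (dual_fun (f2 M G p) y <=
   (dotp y G + \sum_(i < N) \sum_(l < k.+1) X i l * reduced_cost p y i l
    - dotp y s)%:E)%E.
Proof.
move=> X0 s0; apply: ereal_inf_lbound; exists (cost X - G + s, X) => //=.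
rewrite /f2 /cvx_indicator asboolT; last first.
  by apply/feasibleP; split=> // i; have := s0 i; move: (cost X) => C; rewrite !mxE; lra.
by rewrite adde0 -EFinB -lagrangian !dotpDr dotpNr; congr EFin; lra.
Qed.

Lemma dual_fun_eqNy (G : 'rV[R]_N) (p : 'rV[R]_m) (y : 'rV[R]_N)
    (v : R) : v < 0 ->
  (forall t : R, 0 <= t ->
    (dual_fun (f2 M G p) y <= (dotp y G + t * v)%:E)%E) ->
  dual_fun (f2 M G p) y = -oo%E.
Proof.
move=> v0 h; apply: eq_ninfty => A.
(* As [v < 0], this [t] makes [t * v] at most [A - dotp y G]. *)
pose t := Num.max 0 ((A - dotp y G) / v).
have t0 : 0 <= t by rewrite le_max lexx.
apply: (le_trans (h _ t0)); rewrite lee_fin addrC -lerBrDr.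
by rewrite -ler_ndivrMr// le_max lexx orbT.
Qed.

Lemma dual_fun_f2E (G : 'rV[R]_N) (p : 'rV[R]_m) (y : 'rV[R]_N) :
  dual_fun (f2 M G p) y =
  if `[< dual_feasible p y >] then (dotp y G)%:E else -oo%E.
Proof.
case: asboolP => [[y0 red0]|nD].
  apply/eqP; rewrite eq_le; apply/andP; split.
    have := @dual_fun_le G p y 0 0; rewrite big1; last first.
      by move=> i _; rewrite big1// => l _; rewrite mxE mul0r.
    rewrite [dotp y 0]big1; last by move=> i _; rewrite mxE mulr0.
    by rewrite addr0 subr0; apply=> *; rewrite mxE.
  apply/ereal_infP => _ [[u X] _ <-] /=.
  rewrite /f2 /cvx_indicator; case: asboolP => [/feasibleP[X0 hX]|_]; last first.
    by rewrite addey// addye ?leey.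
  rewrite adde0 -EFinB lee_fin.
  have : 0 <= \sum_(i < N) \sum_(l < k.+1) X i l * reduced_cost p y i l.
    by do 2!apply: sumr_ge0 => ? _; rewrite mulr_ge0.
  rewrite -lagrangian.
  (* Since [y <= 0], pairing with [y] reverses the budget constraints. *)
  suff : dotp y (G + u) <= dotp y (cost X) by rewrite dotpDr; lra.
  by apply: ler_sum => i _; rewrite mxE ler_wnM2l.
have [[i yi0]|ny] := pselect (exists i, 0 < y 0 i).
  (* Probe with slack [t] at node [i] alone and no holdings. *)
  apply: (@dual_fun_eqNy _ _ _ (- y 0 i)); first by rewrite oppr_lt0.
  move=> t t0; have := @dual_fun_le G p y (\row_j if j == i then t else 0) 0.
  rewrite big1; last by move=> ? _; rewrite big1// => l _; rewrite mxE mul0r.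
  rewrite [dotp y (\row_j _)](bigD1 i)//= big1; last first.
    by move=> j /negbTE ji; rewrite mxE ji mulr0.
  rewrite mxE eqxx !addr0 mulrN [t * _]mulrC; apply.
    by move=> *; rewrite mxE.
  by move=> j; rewrite mxE; case: ifP.
have [[i [l ril]]|nr] := pselect (exists i l, reduced_cost p y i l < 0).
  (* Probe with [t] units of asset [l] at node [i] alone and no slack. *)
  apply: (@dual_fun_eqNy _ _ _ _ ril) => t t0.
  have := @dual_fun_le G p y 0 (\matrix_(a, b) if (a == i) && (b == l) then t else 0).
  rewrite [dotp y 0]big1; last by move=> j _; rewrite mxE mulr0.
  rewrite (bigD1 i)//= (bigD1 l)//= !big1; first last.
  - by move=> b /negbTE bl; rewrite mxE bl andbF mul0r.
  - by move=> a /negbTE ai; rewrite big1// => b _; rewrite mxE ai mul0r.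
  rewrite mxE !eqxx !addr0 subr0; apply.
    by move=> a b; rewrite mxE; case: ifP.
  by move=> *; rewrite mxE.
case: nD; split=> [i|i l]; rewrite leNgt; apply/negP => h.
  by apply: ny; exists i.
by apply: nr; exists i, l.
Qed.

(** The multiplier decays geometrically with the level, so that the price of an
    asset at a node outweighs those at all of its children. *)
Lemma reduced_cost_interior : exists2 z : 'rV[R]_N, (forall i, z 0 i <= 0) &
  forall i l, 0 <= reduced_cost (const_mx 1) z i l.
Proof.
pose b i l := (\sum_(j < m | leaf_parent tr j == i) leaf_price M j l +
  \sum_(c < N | (c != tree_root tr) && (parent tr c == i)) price M c l).
have b0 i l : 0 <= b i l.
  by rewrite addr_ge0 ?sumr_ge0// => *; rewrite ltW ?price_gt0 ?leaf_price_gt0.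
have q0 i l : 0 <= b i l / price M i l.
  by rewrite divr_ge0// ltW// price_gt0.
(* Adding up all the ratios gives one constant that works for every node and asset; the 1 ensures
   [K >= 1]. *)
pose K := 1 + \sum_(i < N) \sum_(l < k.+1) b i l / price M i l.
have K1 : 1 <= K by rewrite lerDl; do 2!apply: sumr_ge0 => ? _.
have bK i l : b i l <= K * price M i l.
  rewrite -ler_pdivrMr ?price_gt0// /K (bigD1 i)//= (bigD1 l)//=.
  rewrite -!addrA [leRHS]addrCA lerDl addr_ge0// addr_ge0//.
    by apply: sumr_ge0 => ? _.
  by do 2!apply: sumr_ge0 => ? _.
have K0 n : 0 <= K ^+ n by rewrite exprn_ge0// (le_trans ler01).
(* The exponent is still 1 at level [T], where the factor [K] has to outweigh the leaf prices. *)
exists (\row_i - K ^+ (T.+1 - level tr i)); first by move=> i; rewrite mxE oppr_le0.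
move=> i l; rewrite /reduced_cost mxE.
have lvl := level_le tr i.
(* Enlarging the leaf term by a power of [K] gives it the same factor as the children's term [h2],
   so that [bK] bounds both at once. *)
have h1 : \sum_(j < m | leaf_parent tr j == i)
    (const_mx 1 : 'rV[R]_m) 0 j * leaf_price M j l <=
    K ^+ (T - level tr i) *
      \sum_(j < m | leaf_parent tr j == i) leaf_price M j l.
  under eq_bigr do rewrite mxE mul1r.
  rewrite ler_peMl ?exprn_ege1// sumr_ge0// => j _.
  by rewrite ltW ?leaf_price_gt0.
have h2 : \sum_(c < N | (c != tree_root tr) && (parent tr c == i))
      (\row_i - K ^+ (T.+1 - level tr i)) 0 c * price M c l =
    - (K ^+ (T - level tr i) *
      \sum_(c < N | (c != tree_root tr) && (parent tr c == i)) price M c l).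
  rewrite -mulNr big_distrr /=; apply: eq_bigr => c /andP[cr /eqP pc].
  by rewrite mxE (level_parent cr) pc subSS.
have := ler_wpM2l (K0 (T - level tr i)%N) (bK i l).
rewrite h2 subSn// exprS /b mulrDr; move: h1; lra.
Qed.

Lemma dual_feasible_shift (p q : 'rV[R]_m) (y z : 'rV[R]_N) :
  (forall i, z 0 i <= 0) ->
  (forall i l, 0 <= reduced_cost (const_mx 1) z i l) ->
  dual_feasible p y ->
  dual_feasible q (y + \sum_(j < m) `|q 0 j - p 0 j| *: z).
Proof.
move=> z0 hz [y0 hy]; rewrite -scaler_suml.
set e := \sum_(j < m) _.
have e0 : 0 <= e by exact: sumr_ge0.
split=> [i|i l].
  by rewrite 2!mxE; have := mulr_ge0_le0 e0 (z0 i); have := y0 i; lra.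
(* By joint linearity the reduced cost splits into those of [(p, y)], of [e] times [(1, z)], and of
   the remainder with multiplier 0. The last is nonnegative because [q - p <= e] entrywise. *)
have -> : q = p + (e *: const_mx 1 + (q - p - e *: const_mx 1)).
  by apply/rowP => j; rewrite !mxE; lra.
rewrite -[e *: z]addr0 !reduced_costD reduced_costZ.
rewrite addr_ge0// addr_ge0// ?mulr_ge0// /reduced_cost.
rewrite mxE mul0r subr0 [X in _ + X]big1 ?addr0; last first.
  by move=> c _; rewrite mxE mul0r.
rewrite oppr_ge0; apply: sumr_le0 => j _.
rewrite mulr_le0_ge0// ?(ltW (leaf_price_gt0 _ _ _))// !mxE mulr1 subr_le0.
by rewrite (le_trans (ler_norm _))// /e (bigD1 j)//= lerDl sumr_ge0.
Qed.

End Dual.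

(** * Limits of coordinates, finite sums and lower limits *)

Section Limits.
Context {R : realType}.

Lemma cvg_row {d : nat} (u_ : nat -> 'rV[R]_d) (u : 'rV[R]_d) (l : 'I_d) :
  u_ @ \oo --> u -> (fun nu => u_ nu 0 l) @ \oo --> u 0 l.
Proof. by move=> h; exact: (cvg_comp _ _ h (@coord_continuous R 1 d 0 l u)). Qed.

Lemma cvg_sumr {d : nat} (P : pred 'I_d) (f_ : nat -> 'I_d -> R)
    (f : 'I_d -> R) : (forall l, (fun nu => f_ nu l) @ \oo --> f l) ->
  (fun nu => \sum_(l < d | P l) f_ nu l) @ \oo --> \sum_(l < d | P l) f l.
Proof. by move=> h; apply: cvg_big => [|l _]; [exact: add_continuous|exact: h]. Qed.

Lemma cvg_dotp {d : nat} (u_ : nat -> 'rV[R]_d) (u v : 'rV[R]_d) :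
  u_ @ \oo --> u -> (fun nu => dotp (u_ nu) v) @ \oo --> dotp u v.
Proof. by move=> h; apply: cvg_sumr => l; apply: cvgMr_tmp; exact: cvg_row. Qed.

Lemma cvg_l1_dist {d : nat} (u_ : nat -> 'rV[R]_d) (u : 'rV[R]_d) :
  u_ @ \oo --> u ->
  ((fun nu => \sum_(j < d) `|u_ nu 0 j - u 0 j|) : nat -> R) @ \oo --> (0 : R).
Proof.
move=> hu; suff : (fun nu => \sum_(j < d) `|u_ nu 0 j - u 0 j|) @ \oo -->
    \sum_(j < d) `|u 0 j - u 0 j|.
  by rewrite [\sum_(j < d) `|u 0 j - u 0 j|]big1// => j _; rewrite subrr normr0.
apply: cvg_sumr => j; apply: cvg_norm.
by apply: cvgB; [exact: cvg_row|exact: cvg_cst].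
Qed.

Lemma le_limn_einf (u v : (\bar R)^nat) :
  (forall n, u n <= v n)%E -> (limn_einf u <= limn_einf v)%E.
Proof.
move=> uv; rewrite !limn_einf_lim; apply: lee_lim; [exact: is_cvg_einfs..|].
apply: nearW => n; apply: le_ereal_inf_tmp => _ [i ni <-].
by apply: le_trans (uv i); apply: ereal_inf_lbound; exists i.
Qed.

End Limits.

(** A violated constraint is a strict inequality between continuous functions of [(p, y)], hence
    persists along the tail of the sequence. *)
Lemma dual_feasible_closed {R : realType} {k T N m : nat}
    {tr : scenario_tree T N m} (M : market R k tr)
    (p : 'rV[R]_m) (p_ : nat -> 'rV[R]_m)
    (y : 'rV[R]_N) (y_ : nat -> 'rV[R]_N) :
  p_ @ \oo --> p -> y_ @ \oo --> y -> ~ dual_feasible M p y ->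
  \forall nu \near \oo, ~ dual_feasible M (p_ nu) (y_ nu).
Proof.
move=> hp hy nD.
have [[i yi0]|ny] := pselect (exists i, 0 < y 0 i).
  near=> nu; case=> y0 _; have := y0 i; apply/negP; rewrite -ltNge.
  by near: nu; exact: (cvgr_gt _ (cvg_row _ _ i hy)).
have [[i [l ril]]|nr] := pselect (exists i l, reduced_cost M p y i l < 0).
  have hr : (fun nu => reduced_cost M (p_ nu) (y_ nu) i l) @ \oo -->
      reduced_cost M p y i l.
    apply: cvgD; [apply: cvgB; [apply: cvgN|]|].
    - by apply: cvg_sumr => j; apply: cvgMr_tmp; exact: cvg_row.
    - by apply: cvgMr_tmp; exact: cvg_row.
    - by apply: cvg_sumr => c; apply: cvgMr_tmp; exact: cvg_row.
  near=> nu; case=> _ /(_ i l); apply/negP; rewrite -ltNge.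
  by near: nu; exact: (cvgr_lt _ hr).
case: nD; split=> [i|i l]; rewrite leNgt; apply/negP => h.
  by apply: ny; exists i.
by apply: nr; exists i, l.
Unshelve. all: by end_near. Qed.

Theorem theorem4p13 (R : realType) (T k N m : nat)
  (hT : (1 <= T)%N) (hk : (1 <= k)%N)
  (tr : scenario_tree T N m) (M : market R k tr)
  (G : 'rV[R]_N) (hG : claim tr G)
  (p : 'rV[R]_m) (p_ : nat -> 'rV[R]_m)
  (hp : simplex p) (hp_ : forall nu, simplex (p_ nu))
  (hp0 : forall j, j \notin original tr -> p 0 j = 0)
  (hNA : arbitrage_free M p)
  (hlim : p_ @ \oo --> p) :
  hypo_converges (fun nu => dual_fun (f2 M G (p_ nu))) (dual_fun (f2 M G p)).
Proof.
move=> y; split=> [y_ hy|].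
  have [D|nD] := pselect (dual_feasible M p y).
    rewrite dual_fun_f2E asboolT//.
    have /cvg_limn_einf_sup[<- _] :
        (fun nu => (- (dotp (y_ nu) G)%:E)%E) @ \oo --> (- (dotp y G)%:E)%E.
      by apply: cvgeN; apply: cvg_EFin; [exact: nearW|exact: cvg_dotp].
    (* The negated dual value is either [- dotp (y_ nu) G] or [+oo], so the convergent sequence
       bounds it from below. *)
    apply: le_limn_einf => nu; rewrite dual_fun_f2E.
    by case: ifP => // _; rewrite leey.
  suff /cvg_limn_einf_sup[-> _] :
      (fun nu => (- dual_fun (f2 M G (p_ nu)) (y_ nu))%E) @ \oo --> +oo%E.
    exact: leey.
  (* Infeasibility persists, so the negated values are eventually constant [+oo]. *)
  apply: cvg_near_cst; near=> nu; rewrite dual_fun_f2E asboolF//.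
  by near: nu; exact: dual_feasible_closed hlim hy nD.
rewrite dual_fun_f2E; case: asboolP => [D|_]; last first.
  (* The target is [+oo], so any sequence tending to [y] will do. *)
  by exists (fun=> y); [exact: cvg_cst|exact: leey].
have [z z0 hz] := reduced_cost_interior M.
pose y_ nu := y + \sum_(j < m) `|p_ nu 0 j - p 0 j| *: z.
have hy : y_ @ \oo --> y.
  rewrite /y_; under eq_fun do rewrite -scaler_suml.
  have : (fun nu => y + (\sum_(j < m) `|p_ nu 0 j - p 0 j|) *: z) @ \oo -->
      y + 0 *: z.
    by apply: cvgD; [exact: cvg_cst|apply: cvgZr_tmp; exact: cvg_l1_dist].
  by rewrite scale0r addr0.
exists y_ => //.
suff /cvg_limn_einf_sup[_ ->] :
    (fun nu => (- dual_fun (f2 M G (p_ nu)) (y_ nu))%E) @ \oo -->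
    (- (dotp y G)%:E)%E by [].
(* Every [y_ nu] is feasible for [p_ nu], so the dual values are finite and linear in [y_ nu]. *)
under eq_fun => nu.
  rewrite dual_fun_f2E asboolT; last exact: dual_feasible_shift.
  over.
by apply: cvgeN; apply: cvg_EFin; [exact: nearW|exact: cvg_dotp].
Unshelve. all: by end_near. Qed.
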